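(* Let $k\ge 3$. Any totally regular $(1,1,k;-\delta)$-graph has defect $$\delta \geq \sum_{t=1}^{k-2} Z'_t\left\lceil \frac13+\frac13\left\lfloor\frac{k-t}{2}\right\rfloor\right\rceil,$$ where $Z'_1=1$ and, for $t\ge 2$, $$Z'_t=\frac{1}{2^{t-1}\sqrt5}\left((1+\sqrt5)^{t-1}-(1-\sqrt5)^{t-1}\right).$$
   Context: A (finite) mixed graph $G$ consists of a vertex set $V(G)$, a set of undirected edges and a set of directed arcs (ordered pairs of vertices). Loops are forbidden, as are parallel edges and arcs. Write $u\sim v$ if there is an edge between $u$ and $v$, and $u\to v$ if there is an arc from $u$ to $v$. The undirected degree $d(u)$ is the number of edges incident with $u$; the directed out-degree $d^+(u)$ (in-degree $d^-(u)$) is the number of arcs with initial (terminal) vertex $u$. $G$ is totally regular if there are $r,z$ with $d(u)=r$ and $d^+(u)=d^-(u)=z$ for all vertices $u$. A walk of length $\ell$ from $u_0$ to $u_\ell$ is a sequence $u_0u_1\dots u_\ell$ of vertices such that for each $0\le i\le \ell-1$ either $u_i\sim u_{i+1}$ or $u_i\to u_{i+1}$. A mixed path is a non-backtracking walk, i.e. one that never traverses an edge and then immediately retraces it. The distance $d(u,v)$ is the length of a shortest mixed path from $u$ to $v$ ($\infty$ if there is none), and the diameter of $G$ is $\max\{d(u,v):u,v\in V(G)\}$. The mixed Moore bound $M(r,z,k)$ is the number of vertices of the mixed Moore tree of depth $k$: $M(r,z,k)=1+\sum_{t=1}^{k}(E_t+D_t)$, where $E_1=r$, $D_1=z$, $E_{t+1}=(r-1)E_t+rD_t$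 and $D_{t+1}=z(E_t+D_t)$. An $(r,z,k;-\delta)$-graph is a mixed graph with maximum undirected degree $r$, maximum directed out-degree $z$, diameter $k$ and order $M(r,z,k)-\delta$; $\delta$ is its defect. A totally regular $(1,1,k;-\delta)$-graph thus has $d(u)=d^+(u)=d^-(u)=1$ for every vertex $u$. *)

(* Defs.v *)
From HB Require Import structures.
From mathcomp Require Import all_boot all_order all_algebra.
From mathcomp Require Import reals.

Set Implicit Arguments.
Unset Strict Implicit.
Unset Printing Implicit Defensive.

Import Order.TTheory GRing.Theory Num.Theory.

(* Two relations on [V] leave no room for repeated edges or repeated arcs, so  *)
(* the only parallelism to exclude is an edge and an arc on the same pair of   *)
(* vertices; [edge] being symmetric, [mg_simple] covers both orientations of   *)
(* the arc.  A pair of opposite arcs is not regarded as parallel.              *)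
Record mixedGraph (V : finType) := MixedGraph {
  edge : rel V;
  arc : rel V;
  edge_sym : symmetric edge;
  edge_irr : irreflexive edge;
  arc_irr : irreflexive arc;
  mg_simple : forall u v, edge u v -> ~~ arc u v
}.

Section MixedGraph.
Variables (V : finType) (G : mixedGraph V).

Definition udeg (u : V) : nat := #|[set v | edge G u v]|.
Definition outdeg (u : V) : nat := #|[set v | arc G u v]|.
Definition indeg (u : V) : nat := #|[set v | arc G v u]|.

Definition totally_regular : Prop :=
  exists r z : nat, forall u, [/\ udeg u = r, outdeg u = z & indeg u = z].

Definition step : rel V := [rel u v | edge G u v || arc G u v].

(* By [mg_simple], once [u ~ v], returning from [v] to [u] can only be done    *)
(* along that edge, so backtracking can be read off the vertex sequence.       *)
Fixpoint nonbacktracking (s : seq V) : bool :=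
  if s is u :: ((v :: w :: _) as s')
  then (edge G u v ==> (w != u)) && nonbacktracking s' else true.

Definition mixed_path (u : V) (p : seq V) : bool :=
  path step u p && nonbacktracking (u :: p).

Definition joined (u v : V) (l : nat) : Prop :=
  exists p : seq V, [/\ mixed_path u p, last u p = v & size p = l].

Definition is_dist (u v : V) (d : nat) : Prop :=
  joined u v d /\ forall l, joined u v l -> d <= l.

(* An infinite distance, i.e. no [d] with [is_dist u v d], is ruled out by the *)
(* first clause.                                                               *)
Definition has_diameter (k : nat) : Prop :=
  (forall u v, exists2 d, is_dist u v d & d <= k) /\
  (exists u v, is_dist u v k).

End MixedGraph.

(* [moore_level r z t] is the pair (E_(t+1), D_(t+1)): vertices at depth t+1   *)
(* of the Moore tree reached by an edge, resp. by an arc.  For r = 0 every E_t *)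
(* vanishes, so the truncated predecessor is harmless.                         *)
Fixpoint moore_level (r z t : nat) : nat * nat :=
  if t is t'.+1 then
    let ED := moore_level r z t' in
    (r.-1 * ED.1 + r * ED.2, z * (ED.1 + ED.2))
  else (r, z).

Definition moore_bound (r z k : nat) : nat :=
  1 + \sum_(0 <= t < k) ((moore_level r z t).1 + (moore_level r z t).2).

(* The defect is an integer so that subtraction is not truncated and the Moore *)
(* bound (nonnegativity of the defect) is not built in.                        *)
Definition rzk_graph (V : finType) (G : mixedGraph V) (r z k : nat)
    (delta : int) : Prop :=
  [/\ \max_(u : V) udeg G u = r, \max_(u : V) outdeg G u = z,
      has_diameter G k & (#|V|%:Z = (moore_bound r z k)%:Z - delta)%R].

Local Open Scope ring_scope.

Definition Zprime (R : realType) (t : nat) : R :=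
  if t == 1%N then 1
  else (2 ^+ (t - 1) * Num.sqrt 5)^-1 *
       ((1 + Num.sqrt 5) ^+ (t - 1) - (1 - Num.sqrt 5) ^+ (t - 1)).

(* Main.v *)
Require Import Defs.
From HB Require Import structures.
From mathcomp Require Import all_boot all_order all_algebra.
From mathcomp Require Import reals.
From mathcomp Require Import zify ring lra.

(** In a totally regular graph with r = z = 1 every vertex [u] has a single
    edge neighbour [mate u] and a single out-neighbour [out u]; [mate] is an
    involution and [out] a bijection.  Mixed paths from [x] are thus words in
    two letters without two consecutive edges, and the Moore tree of depth [k]
    at [x] splits into the words that are empty or start with the arc, and
    the edge to [mate x] followed by such a word of length at most [k - 1].

    Let [X] be the set of vertices reached by the words of the first kind, i.e.
    [x] together with what is within distance [k - 1] of [out x].  For every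
    vertex [u], either [u] or [mate (out u)] lies in [X]
    ([mem_branch_or_mate_out]): go from [out x] to [out u] by a word of length
    at most [k] and remove its last letter.  If it is an arc, this leads to [u]
    because [out] is injective; if it is an edge, it leads to [mate (out u)].

    A node of the branch at [mate x] whose vertex lies in [X] is redundant,
    since its vertex already occurs in the other branch.  So the defect is at
    least the number of such nodes ([chain_bound_defect]).  To bound that number
    from below, cut the branch at [mate x] into chains
    [u, mate (out u), mate (out (mate (out u))), ...], as long as the depth
    permits.  Of two consecutive nodes in a chain one is redundant, so a chain
    of N nodes has at least N / 2 (rounded down) redundant ones, which is at
    least N / 3 rounded up as soon as N > 1.  The heads of the chains are the
    node [mate x], at depth 1, and the nodes reached by an arc.  There are Z'_t
    heads at depth t, a Fibonacci number for t > 1, and the chain of such a head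
    has N = 1 + (k - t) / 2 nodes (rounded down).  Summing over all chains
    ([count_branch_ge]) gives the bound. *)

Set Implicit Arguments.
Unset Strict Implicit.
Unset Printing Implicit Defensive.

Import Order.TTheory GRing.Theory Num.Theory.
Local Open Scope ring_scope.

(** * The Moore tree as a list of vertices *)

Section Tree.
Local Open Scope nat_scope.
Variables (T : eqType) (out mate : T -> T).

(** A word is a list of letters, [true] for the arc and [false] for the edge. *)
Definition run (u : T) (w : seq bool) : T :=
  foldl (fun v b => if b then out v else mate v) u w.

(** The ends, with multiplicity, of the reduced words of length at most [d] that
    are empty or start with the arc: the part of the Moore tree at [u] that
    hangs below [u] when [u] itself has been entered by its edge. *)
Fixpoint branch (d : nat) (u : T) : seq T :=
  u :: (if d is d1.+1 then
          branch d1 (out u) ++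
          (if d1 is d2.+1 then branch d2 (mate (out u)) else [::])
        else [::]).

Lemma branchSS d u :
  branch d.+2 u = u :: branch d.+1 (out u) ++ branch d (mate (out u)).
Proof. by []. Qed.

Lemma count_branchSS (P : pred T) d u :
  count P (branch d.+2 u) =
  P u + count P (branch d.+1 (out u)) + count P (branch d (mate (out u))).
Proof. by rewrite branchSS -addnA -count_cat. Qed.

Lemma mem_branch_root d u : u \in branch d u.
Proof. by case: d => [|d]; rewrite mem_head. Qed.

(** On words, the relation [orb] forbids two consecutive edges; the initial
    [false] also forbids a first edge. *)
Lemma run_mem_branch d u w :
  path orb false w -> size w <= d -> run u w \in branch d u.
Proof.
have [m] := ubnP (size w); elim: m d u w => // m IH d u.
case=> [|[] w] //=; first by rewrite mem_branch_root.
case: d => // d lt_wm; case: w lt_wm => [|[] w] /= lt_wm red_w le_wd.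
- by rewrite inE mem_cat mem_branch_root orbT.
- by rewrite inE mem_cat (IH d (out u) (true :: w)) ?orbT.
- case: d le_wd => // d le_wd; rewrite inE mem_cat.
  by rewrite (IH d (mate (out u)) w) ?orbT //; apply: ltnW.
Qed.

(** The nodes at depth [d.+1] of a branch are as many as the nodes at that depth
    of the Moore tree reached by an arc, since reversing a reduced word
    exchanges its first and its last letter. *)
Lemma size_branchS d u :
  size (branch d.+1 u) = size (branch d u) + (moore_level 1 1 d).2.
Proof.
elim/ltn_ind: d u => -[|[|d]] IH u //.
have sizeSS e v : size (branch e.+2 v) =
    1 + size (branch e.+1 (out v)) + size (branch e (mate (out v))).
  by rewrite -!count_predT count_branchSS.
rewrite [LHS]sizeSS [X in _ = X + _]sizeSS.
rewrite (IH d.+1) // (IH d (leqnSn d.+1) (mate _)) /=.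
lia.
Qed.

Lemma size_moore_tree d u v :
  size (branch d.+1 u) + size (branch d v) = moore_bound 1 1 d.+1.
Proof.
elim: d u v => [|d IH] u v; first by rewrite /moore_bound big_nat1.
rewrite /moore_bound big_nat_recr // addnA -/(moore_bound 1 1 d.+1).
rewrite -(IH u v) (size_branchS d.+1) (size_branchS d v) /=.
lia.
Qed.

End Tree.

(** * Counting along chains *)

Section Chains.
Local Open Scope nat_scope.

Fixpoint fib (n : nat) : nat :=
  if n is n1.+1 then if n1 is n2.+1 then fib n1 + fib n2 else 1 else 0.

Lemma fibSS n : fib n.+2 = fib n.+1 + fib n. Proof. by []. Qed.

(** What a chain is counted for when [s] levels lie below its head.  For
    [s > 1] this is a third of [1 + s./2], the number of its nodes, rounded up;
    a shorter chain has a single node and is subject to no constraint. *)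
Definition chain_weight (s : nat) : nat := (1 < s) + s %/ 6.

(** The number of chain heads at depth [i] of a branch: the root, and the nodes
    reached by an arc.  This is Z'_(i+1). *)
Definition heads (i : nat) : nat := (i == 0) + fib i.

Definition chain_bound (d : nat) : nat :=
  \sum_(0 <= i < d.+1) heads i * chain_weight (d - i).

(** The generating function of [heads] is (1 - s^2) / (1 - s - s^2). *)
Lemma heads_convolution_rec (f : nat -> nat) d :
  \sum_(0 <= i < d.+3) heads i * f (d.+2 - i) + f d =
  \sum_(0 <= i < d.+2) heads i * f (d.+1 - i) +
  \sum_(0 <= i < d.+1) heads i * f (d - i) + f d.+2.
Proof.
have peel m : \sum_(0 <= i < m.+1) heads i * f (m - i) =
    f m + \sum_(0 <= i < m) fib i.+1 * f (m - i.+1).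
  by rewrite big_nat_recl // subn0 mul1n.
have fibsum : \sum_(0 <= i < d.+1) fib i.+2 * f (d.+1 - i.+1) =
    \sum_(0 <= i < d) fib i.+1 * f (d - i.+1)
    + \sum_(0 <= i < d.+1) fib i.+1 * f (d.+1 - i.+1).
  have -> : \sum_(0 <= i < d) fib i.+1 * f (d - i.+1) =
            \sum_(0 <= i < d.+1) fib i * f (d - i).
    by rewrite [RHS]big_nat_recl.
  rewrite -big_split; apply: eq_bigr => i _.
  by rewrite fibSS addnC mulnDl subSS.
rewrite !peel [X in f d.+2 + X + _]big_nat_recl // subSS subn0 mul1n.
rewrite (eq_big_nat _ _ (F2 := fun i => fib i.+2 * f (d.+1 - i.+1))) //.
rewrite fibsum; lia.
Qed.

(** Four more levels below the head lengthen a chain by two nodes, and one of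
    those two is redundant. *)
Lemma chain_weight4 d : chain_weight (d + 4) <= (chain_weight d).+1.
Proof. rewrite /chain_weight; case: (ltnP 1 d) => h; lia. Qed.

(** Removing the first two nodes of the chain of the root from a branch of depth
    [d + 4] leaves the branches at their arc successors, of depths [d + 3] and
    [d + 1], and the rest of the chain, which starts a branch of depth [d]. *)
Lemma chain_bound_rec d :
  chain_bound d.+4 <=
    (chain_bound d.+3 + chain_bound d.+1 + chain_bound d).+1.
Proof.
(* The weights left over by the two recurrences combine into the difference of
   chain_weight d.+4 and chain_weight d, which is at most 1. *)
have h4 := heads_convolution_rec chain_weight d.+2.
have h2 := heads_convolution_rec chain_weight d.
have := chain_weight4 d; rewrite addn4 /chain_bound; lia.
Qed.

(** The hypothesis says that of two consecutive nodes of a chain, one satisfies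
    [P]. *)
Lemma count_branch_ge (T : eqType) (out mate : T -> T) (P : pred T) :
  (forall u, P u || P (mate (out u))) ->
  forall d u, chain_bound d <= count P (branch out mate d u).
Proof.
move=> hP; elim/ltn_ind => d IH u; have := hP u.
case: d IH => [|[|[|[|d]]]] IH Pu.
- by rewrite /chain_bound big_nat1.
- by rewrite /chain_bound !big_nat_recr // big_nil.
- have -> : chain_bound 2 = 1 by rewrite /chain_bound !big_nat_recr // big_nil.
  by move: Pu => /=; case: (P u); case: (P (mate _)) => //= _; lia.
- have -> : chain_bound 3 = 1 + chain_bound 2.
    by rewrite /chain_bound !big_nat_recr // !big_nil.
  have := IH 2 isT (out u).
  rewrite count_branchSS /=.
  by move: Pu; case: (P u); case: (P (mate _)) => //= _; lia.
- apply: leq_trans (chain_bound_rec d) _.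
  have h3 := IH d.+3 (leqnn _) (out u).
  have h1 := IH d.+1 (ltn_addl 2 (leqnn _)) (out (mate (out u))).
  have h0 := IH d (ltn_addl 3 (leqnn _)) (mate (out (mate (out u)))).
  (* Unfold the branch twice along the chain of u, so that both u and
     mate (out u) appear. *)
  rewrite count_branchSS (count_branchSS _ _ _ d).
  have : 1 <= P u + P (mate (out u)) by case: (P u) Pu => //= ->.
  lia.
Qed.

End Chains.

(** * Redundant nodes in the Moore tree *)

Section Graph.
Local Open Scope nat_scope.
Variables (V : finType) (G : mixedGraph V) (out mate : V -> V).
Hypothesis edgeE : forall u v, edge G u v = (v == mate u).
Hypothesis arcE : forall u v, Defs.arc G u v = (v == out u).
Hypothesis out_inj : injective out.

Let mateK : involutive mate.
Proof. by move=> u; apply/esym/eqP; rewrite -edgeE edge_sym edgeE. Qed.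

Lemma run_mixed_path u p : mixed_path G u p ->
  run out mate u (pairmap (Defs.arc G) u p) = last u p.
Proof.
case/andP=> + _; elim: p u => //= v p IH u /andP[/orP uv /IH <-].
congr foldl; case: ifP => [|not_arc]; first by rewrite arcE => /eqP.
by case: uv => [|uv]; [rewrite edgeE => /eqP | rewrite uv in not_arc].
Qed.

Lemma mixed_path_reduced u p : mixed_path G u p ->
  path orb true (pairmap (Defs.arc G) u p).
Proof.
case/andP; elim: p u => //= v [//|w p] IH u /andP[uv vp] /andP[uvw nb_p].
have := IH v vp nb_p; rewrite /= => ->; rewrite andbT.
apply: contraTT uvw; rewrite negb_or => /andP[/negPf not_uv /negPf not_vw].
move: uv vp; rewrite /step /= not_uv not_vw !orbF => uv /andP[+ _].
by rewrite uv negbK /=; move: uv; rewrite !edgeE => /eqP ->; rewrite mateK.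
Qed.

Variable k : nat.
Hypothesis diameter_le : forall u v,
  exists p, [/\ mixed_path G u p, last u p = v & size p <= k.+1].

Lemma reduced_word_exists u v : exists w,
  [/\ path orb true w, run out mate u w = v & size w <= k.+1].
Proof.
have [p [up <- le_pk]] := diameter_le u v.
exists (pairmap (Defs.arc G) u p); rewrite size_pairmap run_mixed_path //.
by split=> //; apply: mixed_path_reduced.
Qed.

(** A word of length at most [k.+1] from [out x] to [out u] loses its last letter
    and gets the initial arc from [x] to [out x] instead, so its length stays
    within the depth of the branch. *)
Lemma mem_branch_or_mate_out x u :
  (u \in branch out mate k.+1 x) || (mate (out u) \in branch out mate k.+1 x).
Proof.
have [w []] := reduced_word_exists (out x) (out u).
case/lastP: w => [_ /out_inj <- _|w b]; first by rewrite mem_branch_root.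
rewrite rcons_path size_rcons ltnS => /andP[red_w _] + le_wk.
have xw : run out mate x (true :: w) \in branch out mate k.+1 x.
  exact: run_mem_branch.
rewrite /run foldl_rcons -/(run out mate (out x) w).
case: b => [/out_inj <-|<-]; first by rewrite xw.
by rewrite mateK xw orbT.
Qed.

Lemma mem_moore_tree x v :
  v \in branch out mate k.+1 x ++ branch out mate k (mate x).
Proof.
have [w [red_w <- le_wk]] := reduced_word_exists x v; rewrite mem_cat.
case: w red_w le_wk => [|[] w] red_w le_wk.
- by rewrite mem_branch_root.
- by rewrite run_mem_branch.
- by apply/orP; right; apply: (@run_mem_branch _ out mate k (mate x) w).
Qed.

(** Every vertex still occurs in the Moore tree at [x] after the deletion of the
    nodes in the branch at [mate x] whose vertex also occurs in the other
    branch. *)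
Lemma chain_bound_defect (x : V) :
  chain_bound k + #|V| <= moore_bound 1 1 k.+1.
Proof.
set X := branch out mate k.+1 x.
have marked := count_branch_ge (P := mem X) (mem_branch_or_mate_out x).
rewrite -(size_moore_tree out mate k x (mate x)) -/X.
set Y := branch out mate k (mate x).
have : #|V| <= size (X ++ filter (predC (mem X)) Y).
  rewrite cardE; apply: uniq_leq_size (enum_uniq _) _ => v _.
  have := mem_moore_tree x v; rewrite !mem_cat mem_filter /= -/X -/Y.
  by case: (v \in X).
rewrite size_cat size_filter => cardV.
have := marked k (mate x); rewrite -/Y; have := count_predC (mem X) Y; lia.
Qed.

End Graph.

Lemma rel_card1_fun (V : finType) (e : rel V) :
  (forall u, #|[set v | e u v]| = 1%N) ->
  exists f : V -> V, forall u v, e u v = (v == f u).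
Proof.
move=> e1.
suff: forall u, exists w, forall v, e u v = (v == w) by apply: fin_all_exists.
move=> u; have /eqP/cards1P[v /setP ev] := e1 u.
by exists v => w; have := ev w; rewrite !inE.
Qed.

(** * The closed formula *)

Section Formula.
Variable R : realType.

Lemma fib_binet n :
  (2 ^+ n * Num.sqrt 5)^-1 *
    ((1 + Num.sqrt 5) ^+ n - (1 - Num.sqrt 5) ^+ n) = (fib n)%:R :> R.
Proof.
set s : R := Num.sqrt 5.
have s2 : s ^+ 2 = 5 by rewrite sqr_sqrtr.
have s0 : s != 0 by rewrite sqrtr_eq0 -ltNge.
have [m] := ubnP n; elim: m n => // m IH [|[|n]] lt_nm.
- by rewrite !expr0 subrr mulr0.
- by rewrite !expr1 [fib 1]/=; field.
rewrite fibSS natrD -(IH n.+1) // -(IH n) 1?ltnW //.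
have p0 : (2 ^+ n : R) != 0 by rewrite expf_neq0 ?pnatr_eq0.
(* 1 + y and 1 - y are the roots of X^2 = 2 X + 4 when y^2 = 5. *)
have pow_rec (y : R) : (y = s \/ y = - s) ->
    (1 + y) ^+ n.+2 = 2 * (1 + y) ^+ n.+1 + 4 * (1 + y) ^+ n.
  move=> ys; have y2 : y ^+ 2 = 5 by case: ys => ->; rewrite ?sqrrN.
  by rewrite !exprS; ring: y2.
rewrite (pow_rec s) ?(pow_rec (- s)); [|by right|by left].
rewrite [2 ^+ n.+2]exprS [2 ^+ n.+1]exprS; field.
by rewrite p0 s0.
Qed.

Lemma Zprime_heads t : Zprime R t.+1 = (heads t)%:R.
Proof.
rewrite /Zprime /heads eqSS subn1 /=; case: eqP => [->|_] //.
exact: fib_binet.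
Qed.

Lemma ceil_chain_weight (s : nat) : (1 < s)%N ->
  Num.ceil (1 / 3 + 1 / 3 * (Num.floor (s%:R / 2 : R))%:~R : R)
    = (chain_weight s)%:Z.
Proof.
move=> s_gt1.
have -> : Num.floor (s%:R / 2 : R) = (s %/ 2)%:Z.
  apply: floor_def; rewrite intrD -!pmulrn.
  have : s%:R = (s %/ 2)%:R * 2 + (s %% 2)%:R :> R.
    by rewrite -natrM -natrD -divn_eq.
  have : (s %% 2)%:R <= 1 :> R by rewrite lern1 -ltnS ltn_mod.
  have : 0 <= (s %% 2)%:R :> R by rewrite ler0n.
  lra.
apply: ceil_def.
rewrite /chain_weight s_gt1 add1n.
have e : (s %/ 2 = s %/ 6 * 3 + (s %/ 2) %% 3)%N.
  by rewrite [LHS](divn_eq _ 3) -divnMA.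
have : (s %/ 2)%:R = (s %/ 6)%:R * 3 + (s %/ 2 %% 3)%:R :> R.
  by rewrite {1}e natrD natrM.
have : (s %/ 2 %% 3)%:R <= 2 :> R by rewrite ler_nat -ltnS ltn_mod.
have : 0 <= (s %/ 2 %% 3)%:R :> R by rewrite ler0n.
rewrite intrB -!pmulrn -(natr1 (s %/ 6)); lra.
Qed.

(** With depths counted from the root of the branch, [t] becomes [t - 1] and the
    diameter [k.+1] becomes the depth [k] of the branch at [mate x]. *)
Lemma sum_Zprime_chain_bound k :
  \sum_(1 <= t < k) Zprime R t *
     (Num.ceil (1 / 3 + 1 / 3 *
        (Num.floor ((k.+1%:R - t%:R) / 2 : R))%:~R : R))%:~R
  = (chain_bound k)%:R.
Proof.
have -> : chain_bound k =
    (\sum_(0 <= i < k.-1) heads i * chain_weight (k - i))%N.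
  rewrite /chain_bound; case: k => [|k]; first by rewrite big_nat1 big_geq.
  (* The heads on the last two levels have weight zero. *)
  by rewrite !big_nat_recr //= subnn subSnn !muln0 !addn0.
rewrite big_add1 natr_sum; apply: eq_big_nat => i /andP[_ lt_ik].
rewrite Zprime_heads natrM; congr (_ * _).
rewrite -natrB; last lia.
by rewrite subSS ceil_chain_weight //; lia.
Qed.

End Formula.

Theorem theorem19 (R : realType) (V : finType) (G : mixedGraph V)
    (k : nat) (delta : int) :
  (3 <= k)%N ->
  totally_regular G ->
  rzk_graph G 1 1 k delta ->
  \sum_(1 <= t < (k - 2).+1)
     Zprime R t *
     (Num.ceil (1 / 3 + 1 / 3 *
        (Num.floor ((k%:R - t%:R) / 2 : R))%:~R : R))%:~R
  <= delta%:~R.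
Proof.
case: k => [|[|k]] // _ [r [z reg]] [maxr maxz [diam [x _]] cardV].
have big_const (c : nat) (f : V -> nat) :
    (forall u, f u = c) -> (\max_u f u)%N = c.
  move=> fc; apply/eqP; rewrite eqn_leq -{2}(fc x) leq_bigmax andbT.
  by apply/bigmax_leqP => u _; rewrite fc.
have r1 : r = 1%N by rewrite -maxr (big_const r) // => u; case: (reg u).
have z1 : z = 1%N by rewrite -maxz (big_const z) // => u; case: (reg u).
subst r z.
have [mate edgeE] : exists f, forall u v, edge G u v = (v == f u).
  by apply: rel_card1_fun => u; case: (reg u).
have [out arcE] : exists f, forall u v, Defs.arc G u v = (v == f u).
  by apply: rel_card1_fun => u; case: (reg u).
have out_inj : injective out.
  move=> u v uv; have [_ _ /eqP/cards1P[w /setP in_w]] := reg (out u).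
  have := in_w u; have := in_w v; rewrite !inE !arcE uv eqxx.
  by move=> /esym/eqP -> /esym/eqP ->.
have walks u v : exists p,
    [/\ mixed_path G u p, last u p = v & (size p <= k.+2)%N].
  have [d [[p [up pv sp]] _] le_dk] := diam u v.
  by exists p; rewrite sp.
have := chain_bound_defect edgeE arcE out_inj walks x.
have -> : delta = (moore_bound 1 1 k.+2)%:Z - #|V|%:Z by rewrite cardV subKr.
by rewrite subSS subn1 /= sum_Zprime_chain_bound pmulrn ler_int lerBrDr lez_nat.
Qed.
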